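(* Assume (B1)-(B9) (listed in the context). For any $\varepsilon>0$ there exists a control $u^\varepsilon\in\mathcal U$ such that $$J(u^\varepsilon)\le\inf_{u\in\mathcal U}J(u)+\varepsilon.$$
   Context: Fix $T>0$. $I=\{0,1,2,\dots\}$ with the discrete topology. $\Omega=D([0,T],I)$ is the space of functions $[0,T]\to I$ that are right-continuous with left limits on $[0,T)$ and left-continuous at $T$, with the Skorohod metric and Borel $\sigma$-field $\mathcal F$. $x(t,\omega)=\omega(t)$ is the coordinate process, $\mathcal F^0_t=\sigma(x(s),s\le t)$, $|w|_t=\sup_{0\le s\le t}|w(s)|$. $I_i(t)=\mathbf 1_{\{x(t)=i\}}$, and for $i\neq j$, $N_{ij}(t)=\#\{\tau\in(0,t]:x(\tau^-)=i,\ x(\tau)=j\}$. $\mathcal P(I)$ is the set of probability measures on $I$, $\mathcal P_p(I)$ those with finite $p$-th moment, $d(\mu,\nu)=\sum_i|\mu(\{i\})-\nu(\{i\})|$. $\|Q\|_2^2:=\int_\Omega|w|_T^2\,Q(dw)$ and $\mathcal P_2(\Omega)$ is the set of probability measures $Q$ on $(\Omega,\mathcal F)$ with $\|Q\|_2<\infty$. $Q\circ x^{-1}(t)$ is the law of $x(t)$ under $Q$. Reference measure: $G=(g_{ij})$ is a time-independent $Q$-matrix: $g_{ij}\ge0$ for $i\ne j$, $g_{ii}=-\sum_{j\ne i}g_{ij}$, $\sum_{i\ne j}g_{ij}<\infty$; there is $\alpha>0$ with $\sum_{i\neq j}e^{\alpha|j-i|}g_{ij}<\infty$; $c_2:=\inf_{i\ne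 j}g_{ij}>0$. $P$ is the probability measure on $(\Omega,\mathcal F)$ under which $x$ is a time-homogeneous Markov chain with intensity matrix $G$ and initial law $\xi$; $\mathbb F=(\mathcal F_t)$ is the completion of $(\mathcal F_t^0)$ with the $P$-null sets. Here $x(0)$ is a given deterministic point of $I$ ($\xi$ is a Dirac mass) and $\mathcal F_0$ is trivial. Convention: only nonzero jump intensities are taken into account, i.e. all sums, products, infima and lower bounds over pairs $i\ne j$ range over pairs with $g_{ij}>0$. Controls: $(U,\delta)$ is a compact metric space and $\mathcal U$ the set of $\mathbb F$-progressively measurable $U$-valued processes. $C$ is a generic positive constant. For $u\in\mathcal U$, $P^u$ is the probability measure with $P^u\circ x^{-1}(0)=\xi$ under which $x$ is a jump process with intensities $\lambda^u_{ij}(t):=\lambda_{ij}(t,x,P^u\circ x^{-1}(t),u(t))$; i.e. $P^u$ is the fixed point of the map $Q\mapsto L^{u,Q}(T)\,dP$ on $\mathcal P_2(\Omega)$, where $$L^{u,Q}(t)=\prod_{i\ne j}\exp\Big\{\int_{(0,t]}\ln\frac{\lambda_{ij}(s,x,Q\circ x^{-1}(s),u(s))}{g_{ij}}\,dN_{ij}(s)-\int_0^t(\lambda_{ij}(s,x,Q\circ x^{-1}(s),u(s))-g_{ij})I_i(s)\,ds\Big\}.$$ $E^u$ is expectation under $P^u$. Assumptions: (B1) For $u\in\mathcal U$, $(\lambda_{ij}(t,x,P^u\circ x^{-1}(t),u(t)))_t$ is predictable. (B2) There is $c_1>0$ with $\lambda_{ij}(t,w,\mu,u)\ge c_1$ for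 all $t$, $i\ne j$, $w\in\Omega$, $u\in U$, $\mu\in\mathcal P(I)$. (B3) For $p=1,2$, all $t,w,u\in U$, $\mu\in\mathcal P_2(I)$: $\sum_{i\ne j}|j-i|^p\lambda_{ij}(t,w,\mu,u)\le C(1+|w|_t^p+\int|y|^p\mu(dy))$. (B4) For $p=1,2$, all $t$, $w,\tilde w\in\Omega$, $\mu,\nu\in\mathcal P(I)$, $u,v\in U$: $\sum_{i\ne j}|j-i|^p|\lambda_{ij}(t,w,\mu,u)-\lambda_{ij}(t,\tilde w,\nu,v)|\le C(|w-\tilde w|_t^p+d^p(\mu,\nu)+\delta^p(u,v))$. (B5) For all $t,w,u\in U$, $\mu\in\mathcal P_1(I)$: $\sum_{i\ne j}\lambda_{ij}^2(t,w,\mu,u)\le C(1+|w|_t+\int|y|\mu(dy))$. (B6) There is $\alpha>0$ with $\int e^{\alpha y}\xi(dy)<\infty$. Data: $f:[0,T]\times\Omega\times\mathcal P_2(I)\times U\to\mathbb R$ and $h:I\times\mathcal P_2(I)\to\mathbb R$ are measurable, with: (B7) for $u\in\mathcal U$, $Q\in\mathcal P_2(\Omega)$, $(f(t,x,Q\circ x^{-1}(t),u(t)))_t$ is progressively measurable and $h(x(T),Q\circ x^{-1}(T))$ is $\mathcal F_T$-measurable; (B8) $|f(t,w,\mu,u)-f(t,w,\nu,v)|\le C(d(\mu,\nu)+\delta(u,v))$ and $|h(y,\mu)-h(y,\nu)|\le C\,d(\mu,\nu)$; (B9) $f$ and $h$ are uniformly bounded. Cost: $J(u)=E^u\big[\int_0^Tf(t,x,P^u\circ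 x^{-1}(t),u(t))\,dt+h(x(T),P^u\circ x^{-1}(T))\big]$, $u\in\mathcal U$. *)

(* Defs.v *)
From HB Require Import structures.
From mathcomp Require Import all_boot all_order all_algebra.
From mathcomp Require Import all_classical all_reals all_analysis.
From mathcomp Require Import lra.

Set Implicit Arguments.
Unset Strict Implicit.
Unset Printing Implicit Defensive.
Import Order.TTheory GRing.Theory Num.Theory.
Import numFieldNormedType.Exports.
Local Open Scope classical_set_scope.
Local Open Scope ring_scope.

(* D([0,T], nat). A path is represented by its unique extension to the whole
   line that is constant on ]-oo, 0] and on [T, +oo[; with this convention two
   paths are equal iff they agree on [0,T]. Limits in nat are those of the
   discrete topology. *)
Record cadlag_path (R : realType) (T : {posnum R}) := CadlagPath {
  path_fun :> R -> nat ;
  path_right_continuous : forall t, 0 <= t < T%:num ->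
    path_fun s @[s --> t^'+] --> path_fun t ;
  path_left_limit : forall t, 0 < t < T%:num ->
    exists l : nat, path_fun s @[s --> t^'-] --> l ;
  path_left_continuous_end :
    path_fun s @[s --> T%:num^'-] --> path_fun T%:num ;
  path_before : forall t, t < 0 -> path_fun t = path_fun 0 ;
  path_after : forall t, T%:num < t -> path_fun t = path_fun T%:num }.

Section path_space.
Context (R : realType) (T : {posnum R}).

HB.instance Definition _ := gen_eqMixin (cadlag_path T).
HB.instance Definition _ := gen_choiceMixin (cadlag_path T).

Program Definition zero_path : cadlag_path T :=
  @CadlagPath R T (fun=> 0%N) _ _ _ _ _.
Next Obligation. by move=> *; exact: cvg_cst. Qed.
Next Obligation. by move=> *; exists 0%N; exact: cvg_cst. Qed.
Next Obligation. exact: cvg_cst. Qed.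
Next Obligation. by []. Qed.
Next Obligation. by []. Qed.

HB.instance Definition _ := isPointed.Build (cadlag_path T) zero_path.

Definition time_change (l : R -> R) : Prop :=
  [/\ l 0 = 0, l T%:num = T%:num, {within `[0, T%:num], continuous l} &
      {in `[0, T%:num] &, {homo l : s t / s < t}}].

(* inf over time changes l of max (|l - id|_T, |w - w' o l|_T) *)
Definition skorokhod_dist (w w' : cadlag_path T) : \bar R :=
  ereal_inf [set maxe
      (ereal_sup [set `|l t - t|%:E | t in `[0, T%:num]])
      (ereal_sup [set `|(w t)%:R - (w' (l t))%:R|%:E | t in `[0, T%:num]])
    | l in time_change].

Definition skorokhod_open (A : set (cadlag_path T)) : Prop :=
  forall w, A w -> exists2 e : R, 0 < e &
    forall w', (skorokhod_dist w w' < e%:E)%E -> A w'.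

Definition Omega := g_sigma_algebraType skorokhod_open.

Definition coord (t : R) (w : Omega) : nat := path_fun w t.

Let dist_nat_lt1 (m n : nat) : `|m%:R - n%:R| < 1 :> R -> m = n.
Proof.
have le_of (a b : nat) : a%:R - b%:R < 1 :> R -> (a <= b)%N.
  by rewrite ltrBlDl natr1 ltr_nat ltnS.
move=> h; apply/eqP; rewrite eqn_leq !le_of//.
  by rewrite distrC in h; exact: le_lt_trans (ler_norm _) h.
exact: le_lt_trans (ler_norm _) h.
Qed.

Let skorokhod_close (w w' : cadlag_path T) (e : R) : e <= 1 ->
    (skorokhod_dist w w' < e%:E)%E ->
  exists2 l, time_change l &
    forall t, t \in `[0, T%:num] -> `|l t - t| < e /\ w' (l t) = w t.
Proof.
move=> e1 /ereal_inf_lt[_ [l tl <-]]; rewrite gt_max => /andP[h1 h2].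
exists l => // t tT; split.
  rewrite -lte_fin; apply: le_lt_trans h1; apply: ereal_sup_ubound.
  by exists t.
apply/esym/dist_nat_lt1/(lt_le_trans _ e1).
rewrite -lte_fin; apply: le_lt_trans h2.
by apply: ereal_sup_ubound; exists t.
Qed.

Let level (a b : R) (n : nat) : set Omega :=
  [set w | forall s, a < s < b -> coord s w = n].

Let measurable_level (a b : R) n :
  0 <= a -> b <= T%:num -> measurable (level a b n).
Proof.
move=> a0 bT; rewrite -[level a b n]setCK; apply: measurableC.
apply: sub_sigma_algebra => w /existsNP[s /not_implyP[/andP[sa sb] wsn]].
exists (Order.min 1 (Order.min (s - a) (b - s))).
  by rewrite !lt_min ltr01 !subr_gt0 sa sb.
move=> w' /skorokhod_close[|l _ Hl]; first by rewrite ge_min lexx.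
have sT : s \in `[0, T%:num].
  by rewrite in_itv/= (ltW (le_lt_trans a0 sa)) (ltW (lt_le_trans sb bT)).
have [+ ls] := Hl _ sT; rewrite !lt_min => /and3P[_].
rewrite !ltr_norml => /andP[l1 _] /andP[_ l4] w'n.
apply: wsn; rewrite /coord -ls; apply: w'n; apply/andP; split; lra.
Qed.

Let measurable_end n : measurable [set w : Omega | coord T%:num w = n].
Proof.
apply: sub_sigma_algebra => w /= wT; exists 1 => //.
move=> w' /skorokhod_close[//|l [_ lT _ _] Hl].
have [] := Hl T%:num; first by rewrite in_itv/= lexx andbT.
by rewrite lT -wT.
Qed.

Let coord_level (t : R) n : 0 <= t < T%:num ->
  [set w : Omega | coord t w = n] =
  \bigcup_k level t (Order.min T%:num (t + k.+1%:R^-1)) n.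
Proof.
move=> tT; have [t0 ltT] := andP tT; apply/seteqP; split => [w /= wt|w [k _ wk]].
  have ws : \forall s \near t^'+, coord s w = n.
    have := path_right_continuous (c := w) tT (discrete_set1 _).
    by rewrite -[path_fun w t]/(coord t w) wt.
  case: ws => e /= e0 we.
  have [k _ /(_ _ (leqnn k)) /= ke] := near_infty_natSinv_lt (PosNum e0).
  exists k => // s; rewrite lt_min => /andP[ts /andP[_ sk]].
  move: ke sk; set r := _^-1 => ke sk.
  by apply: we => //=; rewrite ltr_norml; apply/andP; split; lra.
have ws : \forall s \near t^'+, coord s w = n.
  near=> s; apply: wk; rewrite lt_min; apply/and3P; split; near: s.
  - exact: nbhs_right_gt.
  - exact: nbhs_right_lt.
  - by apply: nbhs_right_lt; rewrite ltrDl invr_gt0 ltr0n.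
have wt : \forall s \near t^'+, coord s w = coord t w.
  exact: (path_right_continuous (c := w) tT (discrete_set1 _)).
near t^'+ => s; rewrite /=.
have <- : coord s w = coord t w by near: s; exact: wt.
by near: s; exact: ws.
Unshelve. all: by end_near.
Qed.

Let measurable_coord (t : R) : measurable_fun [set: Omega] (coord t).
Proof.
suff mt n : measurable [set w : Omega | coord t w = n].
  move=> _ Y _; rewrite setTI.
  have -> : coord t @^-1` Y = \bigcup_(n in Y) [set w | coord t w = n].
    apply/seteqP; split => [w Yw|w [n Yn /= wn]].
      by exists (coord t w).
    by rewrite /= wn.
  exact: bigcup_measurable.
have m0T s : 0 <= s <= T%:num -> measurable [set w : Omega | coord s w = n].
  move=> /andP[s0]; rewrite le_eqVlt => /predU1P[->|sT]; first exact: measurable_end.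
  rewrite coord_level ?s0// ; apply: bigcup_measurable => k _.
  by apply: measurable_level => //; rewrite ge_min lexx.
have [t0|t0] := ltP t 0.
  rewrite (_ : [set w | _] = [set w : Omega | coord 0 w = n]); first by apply: m0T; rewrite lexx/=.
  by apply/seteqP; split => w; rewrite /= /coord path_before.
have [tT|Tt] := leP t T%:num; first by apply: m0T; rewrite t0.
rewrite (_ : [set w | _] = [set w : Omega | coord T%:num w = n]).
  exact: measurable_end.
by apply/seteqP; split => w; rewrite /= /coord (path_after _ Tt).
Qed.

HB.instance Definition _ t :=
  isMeasurableFun.Build _ _ _ _ (coord t) (measurable_coord t).

End path_space.

Section processes.
Context (R : realType) (T : {posnum R}).
Local Notation Omega := (Omega T).

Definition law (Q : probability Omega R) (t : R) : probability nat R :=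
  distribution Q (coord t : {mfun Omega >-> nat}).

(* |v|_t *)
Definition sup_norm (v : R -> R) (t : R) : R := sup [set `|v s| | s in `[0, t]].

Definition path_norm (w : Omega) (t : R) : R :=
  sup_norm (fun s => (coord s w)%:R) t.

(* sum_i |mu {i} - nu {i}|, which is at most 2 *)
Definition dist_prob (mu nu : probability nat R) : R :=
  fine (\esum_(i in [set: nat]) `|mu [set i] - nu [set i]|)%E.

Definition moment (p : nat) (mu : probability nat R) : \bar R :=
  (\int[mu]_y (y%:R ^+ p)%:E)%E.

Definition probs_with_moment (p : nat) : set (probability nat R) :=
  [set mu | moment p mu < +oo]%E.

Definition path_probs2 : set (probability Omega R) :=
  [set Q | \int[Q]_w ((path_norm w T%:num) ^+ 2)%:E < +oo]%E.

(* For a sigma-algebra S on the set D and a class B of target sets. *)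
Definition measurable_wrt (X V : Type) (D : set X) (S : set (set X))
    (B : set (set V)) (f : X -> V) : Prop :=
  forall A, B A -> S (D `&` f @^-1` A).

Definition borelR : set (set R) := @measurable _ (measurableTypeR R).

Definition borel_of (U : topologicalType) : set (set U) := <<s @open U >>.
Arguments borel_of U : clear implicits.

Definition natural_filtration (t : R) : set (set Omega) :=
  <<s [set A | exists2 s, s \in `[0, t] & exists B, A = coord s @^-1` B] >>.

(* The null sets added need not be Borel. *)
Definition completed_filtration (P : probability Omega R) (t : R) :
    set (set Omega) :=
  <<s natural_filtration t `|` [set A | P.-negligible A] >>.

Definition progressively_measurable (P : probability Omega R) (V : Type)
    (B : set (set V)) (Y : R -> Omega -> V) : Prop :=
  forall t, t \in `[0, T%:num] ->
    let D := `[0, t] `*` [set: Omega] in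
    measurable_wrt D
      <<s D, [set C | exists A F, [/\ borelR A, completed_filtration P t F &
                                      C = (`[0, t] `&` A) `*` F]] >>
      B (fun z => Y z.1 z.2).

Definition predictable (P : probability Omega R) (Y : R -> Omega -> R) : Prop :=
  let D := `[0, T%:num] `*` [set: Omega] in
  measurable_wrt D
    <<s D, [set C | exists2 F, completed_filtration P 0 F &
                               C = [set 0] `*` F] `|`
           [set C | exists s t F, [/\ 0 <= s, s < t, t <= T%:num,
                                      completed_filtration P s F &
                                      C = `]s, t] `*` F]] >>
    borelR (fun z => Y z.1 z.2).

Definition controls (P : probability Omega R) (U : topologicalType) :
    set (R -> Omega -> U) :=
  [set u | progressively_measurable P (borel_of U) u].

Definition jump_size (i j : nat) : R := `|j%:R - i%:R|.

(* Only the pairs with a nonzero reference intensity are taken into account. *)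
Definition jump_pairs (g : nat -> nat -> R) : set (nat * nat) :=
  [set ij | ij.1 != ij.2 /\ 0 < g ij.1 ij.2].

Definition jump_times (w : Omega) (i j : nat) (t : R) : set R :=
  [set tau | [/\ 0 < tau <= t, coord s w @[s --> tau^'-] --> i &
                 coord tau w = j]].

(* The integral of phi over ]0, t] against N_ij: a sum over the jump times,
   which are finitely many since w is cadlag on a compact interval. *)
Definition jump_integral (w : Omega) (i j : nat) (t : R) (phi : R -> R) : R :=
  \sum_(tau \in jump_times w i j t) phi tau.

Definition q_matrix (g : nat -> nat -> R) : Prop :=
  [/\ forall i j, i != j -> 0 <= g i j,
      forall i, (- g i i)%:E = \esum_(j in [set j | j != i]) (g i j)%:E &
      (\esum_(ij in jump_pairs g) (g ij.1 ij.2)%:E < +oo)%E].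

Definition exp_jump_moment (g : nat -> nat -> R) : Prop :=
  exists2 alpha : R, 0 < alpha &
    (\esum_(ij in jump_pairs g)
       (expR (alpha * jump_size ij.1 ij.2) * g ij.1 ij.2)%:E < +oo)%E.

Definition rates_bounded_below (g : nat -> nat -> R) : Prop :=
  exists2 c : R, 0 < c & forall ij, jump_pairs g ij -> c <= g ij.1 ij.2.

(* p t i j is the probability of being in j a time t after being in i; the
   intensity matrix is its right derivative at 0. *)
Definition transition_function (g : nat -> nat -> R) (p : R -> nat -> nat -> R) :
    Prop :=
  [/\ forall t i j, 0 <= t -> 0 <= p t i j,
      forall t i, 0 <= t -> (\esum_(j in [set: nat]) (p t i j)%:E = 1)%E,
      forall s t i j, 0 <= s -> 0 <= t ->
        (\esum_(k in [set: nat]) (p s i k * p t k j)%:E = (p (s + t) i j)%:E)%E,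
      forall i j, p 0 i j = (i == j)%:R &
      forall i j, (p h i j - (i == j)%:R) / h @[h --> 0^'+] --> g i j].

Definition markov_chain (P : probability Omega R) (g : nat -> nat -> R)
    (xi : probability nat R) : Prop :=
  (forall B, law P 0 B = xi B) /\
  exists2 p, transition_function g p &
    forall s t F i j, 0 <= s -> s <= t -> t <= T%:num ->
      natural_filtration s F ->
      (P (F `&` [set w | coord s w = i] `&` [set w | coord t w = j]) =
       P (F `&` [set w | coord s w = i]) * (p (t - s) i j)%:E)%E.

Section control.
Context (U : metricType R).
Local Notation intensities :=
  (nat -> nat -> R -> Omega -> probability nat R -> U -> R).
Implicit Types (P Q : probability Omega R) (xi : probability nat R)
  (g : nat -> nat -> R) (lam : intensities) (u : R -> Omega -> U).

Definition likelihood g lam u Q (t : R) (w : Omega) : R :=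
  let l i j s := lam i j s w (law Q s) (u s w) in
  limn (fun n => \prod_(i < n) \prod_(j < n | (i != j) && (0 < g i j))
    expR (jump_integral w i j t (fun s => ln (l i j s / g i j)) -
          \int[lebesgue_measure]_(s in `[0, t])
             ((l i j s - g i j) * (coord s w == i)%:R))).

(* The likelihood is measurable for the P-completion of the Borel sets only;
   for such a nonnegative function the integral below (a supremum over simple
   Borel functions) is the integral against the completed measure. The same
   holds for the expectation in [cost]. *)
Definition is_controlled_law P xi g lam u Q : Prop :=
  [/\ path_probs2 Q, forall B, law Q 0 B = xi B &
      forall A, measurable A ->
        (Q A = \int[P]_(w in A) (likelihood g lam u Q T%:num w)%:E)%E].

(* The fixed point of Q |-> likelihood . P among the path laws with a finite
   second moment, by definite description. *)
Definition controlled_law P xi g lam u : probability Omega R :=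
  get (is_controlled_law P xi g lam u).

Definition intensities_predictable P xi g lam : Prop :=
  forall u, controls P u -> forall ij, jump_pairs g ij ->
    predictable P (fun t w =>
      lam ij.1 ij.2 t w (law (controlled_law P xi g lam u) t) (u t w)).

Definition intensities_bounded_below g lam : Prop :=
  exists2 c : R, 0 < c & forall t ij w mu v, t \in `[0, T%:num] ->
    jump_pairs g ij -> c <= lam ij.1 ij.2 t w mu v.

Definition intensities_growth g lam : Prop :=
  forall p, p \in [:: 1; 2]%N -> exists2 C : R, 0 < C &
    forall t w mu v, t \in `[0, T%:num] -> probs_with_moment 2 mu ->
      (\esum_(ij in jump_pairs g)
         (jump_size ij.1 ij.2 ^+ p * lam ij.1 ij.2 t w mu v)%:E <=
       C%:E * (1 + (path_norm w t ^+ p)%:E + moment p mu))%E.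

Definition intensities_lipschitz g lam : Prop :=
  forall p, p \in [:: 1; 2]%N -> exists2 C : R, 0 < C &
    forall t w w' mu nu v v', t \in `[0, T%:num] ->
      (\esum_(ij in jump_pairs g)
         (jump_size ij.1 ij.2 ^+ p *
          `|lam ij.1 ij.2 t w mu v - lam ij.1 ij.2 t w' nu v'|)%:E <=
       (C * (sup_norm (fun s => (coord s w)%:R - (coord s w')%:R) t ^+ p +
             dist_prob mu nu ^+ p + mdist v v' ^+ p))%:E)%E.

Definition intensities_square_growth g lam : Prop :=
  exists2 C : R, 0 < C &
    forall t w mu v, t \in `[0, T%:num] -> probs_with_moment 1 mu ->
      (\esum_(ij in jump_pairs g) (lam ij.1 ij.2 t w mu v ^+ 2)%:E <=
       C%:E * (1 + (path_norm w t)%:E + moment 1 mu))%E.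

Definition exp_moment xi : Prop :=
  exists2 alpha : R, 0 < alpha & (\int[xi]_y (expR (alpha * y%:R))%:E < +oo)%E.

Implicit Types (f : R -> Omega -> probability nat R -> U -> R)
  (h : nat -> probability nat R -> R).

(* The sigma-algebra on P(nat) is generated by the evaluations mu |-> mu A; it
   is the Borel sigma-algebra of dist_prob. *)
Definition running_cost_measurable f : Prop :=
  let D := [set z : R * Omega * probability nat R * U |
              z.1.1.1 \in `[0, T%:num] /\ probs_with_moment 2 z.1.2] in
  measurable_wrt D
    <<s D, [set C | exists A F M V,
       [/\ borelR A, measurable F, @measurable _ (pprobability nat R) M,
           borel_of U V & C = D `&` (A `*` F `*` M `*` V)]] >>
    borelR (fun z => f z.1.1.1 z.1.1.2 z.1.2 z.2).

Definition terminal_cost_measurable h : Prop :=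
  let D := [set: nat] `*` probs_with_moment 2 in
  measurable_wrt D
    <<s D, [set C | exists A M, @measurable _ (pprobability nat R) M /\
                                C = D `&` (A `*` M)] >>
    borelR (fun z => h z.1 z.2).

Definition costs_adapted P f h : Prop :=
  forall u Q, controls P u -> path_probs2 Q ->
    progressively_measurable P borelR (fun t w => f t w (law Q t) (u t w)) /\
    measurable_wrt [set: Omega] (completed_filtration P T%:num) borelR
      (fun w => h (coord T%:num w) (law Q T%:num)).

Definition costs_lipschitz f h : Prop :=
  exists2 C : R, 0 < C & forall mu nu,
    probs_with_moment 2 mu -> probs_with_moment 2 nu ->
    (forall t w v v', t \in `[0, T%:num] ->
       `|f t w mu v - f t w nu v'| <= C * (dist_prob mu nu + mdist v v')) /\
    (forall y, `|h y mu - h y nu| <= C * dist_prob mu nu).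

Definition costs_bounded f h : Prop :=
  exists C : R, forall mu, probs_with_moment 2 mu ->
    (forall t w v, t \in `[0, T%:num] -> `|f t w mu v| <= C) /\
    (forall y, `|h y mu| <= C).

Definition cost P xi g lam f h u : \bar R :=
  let Pu := controlled_law P xi g lam u in
  let X w :=
    \int[lebesgue_measure]_(t in `[0, T%:num]) f t w (law Pu t) (u t w) +
    h (coord T%:num w) (law Pu T%:num) in
  ('E_Pu[X])%E.

End control.
End processes.

(* Main.v *)
Require Import Defs.
From HB Require Import structures.
From mathcomp Require Import all_boot all_order all_algebra.
From mathcomp Require Import all_classical all_reals all_analysis.
From mathcomp Require Import measurable_realfun lra.

Set Implicit Arguments.
Unset Strict Implicit.
Unset Printing Implicit Defensive.
Import Order.TTheory GRing.Theory Num.Theory.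
Import numFieldNormedType.Exports.
Local Open Scope classical_set_scope.
Local Open Scope ring_scope.

(** A real-valued functional that is bounded below on a nonempty set has
    almost-minimizers for every positive tolerance, so all that matters is that
    the set of controls is nonempty and that J is bounded on it.

    Constant controls show nonemptiness ([constant_control]). For the bound
    ([cost_bounded]), the running and terminal costs are uniformly bounded by
    some C as long as the measure they are evaluated at has a finite second
    moment; the pathwise cost is then at most C T + C in absolute value, and so
    is its expectation under a probability measure. Hence the point that needs
    an argument is that the time marginals of a controlled law have a finite
    second moment ([controlled_law_moment]). A controlled law is a path law
    whose running supremum over [0, T] is square integrable, and that supremum
    dominates each x(t). This uses that a cadlag path in a discrete space is
    bounded on [0, T] ([path_bounded]): the supremum of an unbounded set of
    reals is 0 by convention and would dominate nothing.

    The cost is measurable for a completed sigma-algebra only, so the estimates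
    are made on the integral as it is defined for arbitrary functions, namely a
    difference of suprema over simple functions below the positive and negative
    parts ([ge0_le_integral_nonmeasurable], [abse_integral_le_bound]). *)

Section integral_bounds.
Context d (X : measurableType d) (R : realType).
Context (mu : {measure set X -> \bar R}).
Local Open Scope ereal_scope.

(** For nonnegative functions the integral is a supremum over the simple
    functions below the integrand, and enlarging the integrand only adds
    competitors. *)
Lemma ge0_le_integral_nonmeasurable (D : set X) (F G : X -> \bar R) :
  (forall x, D x -> 0 <= F x) -> (forall x, D x -> F x <= G x) ->
  \int[mu]_(x in D) F x <= \int[mu]_(x in D) G x.
Proof.
move=> F0 FG; have G0 x : D x -> 0 <= G x.
  by move=> Dx; exact: le_trans (F0 _ Dx) (FG _ Dx).
rewrite !ge0_integralE//; apply: ereal_sup_le => _ [k kF <-].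
exists k => // x; apply: le_trans (kF x) _; rewrite !patchE.
by case: ifPn => //; rewrite inE; exact: FG.
Qed.

(** Both the positive and the negative part have an integral between 0 and
    M mu(D), so their difference lies in [- M mu(D), M mu(D)]. The usual route
    through the integral of |F| would need additivity, hence measurability. *)
Lemma abse_integral_le_bound (D : set X) (F : X -> \bar R) (M : R) :
  measurable D -> mu D < +oo -> (forall x, D x -> `|F x| <= M%:E) ->
  `|\int[mu]_(x in D) F x| <= M%:E * mu D.
Proof.
move=> mD Doo FM.
have part_bound (G : X -> \bar R) : (forall x, D x -> 0 <= G x) ->
    (forall x, D x -> G x <= M%:E) ->
    0 <= \int[mu]_(x in D) G x <= M%:E * mu D.
  move=> G0 GM; rewrite integral_ge0//= -(integral_cst mu mD).
  exact: ge0_le_integral_nonmeasurable.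
have /andP[p0 pM] : 0 <= \int[mu]_(x in D) F^\+ x <= M%:E * mu D.
  apply: part_bound => x Dx; first by rewrite funepos_ge0.
  apply: le_trans (FM x Dx); rewrite funeposE.
  by rewrite ge_max lee_abs/= abse_ge0.
have /andP[n0 nM] : 0 <= \int[mu]_(x in D) F^\- x <= M%:E * mu D.
  apply: part_bound => x Dx; first by rewrite funeneg_ge0.
  apply: le_trans (FM x Dx); rewrite funenegE -abseN.
  by rewrite ge_max lee_abs/= abse_ge0.
rewrite integralE.
have /fineK mDE : mu D \is a fin_num by rewrite ge0_fin_numE.
move: p0 pM n0 nM; rewrite -mDE -EFinM.
case: (\int[mu]_(x in D) F^\+ x) => [p| |]//.
case: (\int[mu]_(x in D) F^\- x) => [n| |]//.
rewrite -EFinB /= !lee_fin => p0 pM n0 nM.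
rewrite ler_norml; apply/andP; split; lra.
Qed.

End integral_bounds.

Section paths.
Context (R : realType) (T : {posnum R}).
(* The same name denotes the coordinates of a vector in a basis. *)
Local Notation coord := Defs.coord.

(** One-sided limits in a discrete space are eventually attained: near t the
    path takes at most one value on each side, besides its value at t. At the
    ends of [0, T] the constant extension of the path provides the outer
    one-sided limit. *)
Lemma path_locally_bounded (w : Omega T) (t : R) : t \in `[0, T%:num] ->
  exists n : nat, \forall s \near t, (coord s w <= n)%N.
Proof.
rewrite in_itv/= => /andP[t0 tT].
have [l wl] : exists l, \forall s \near t^'-, coord s w = l.
  move: t0; rewrite le_eqVlt => /predU1P[<-|t0].
    exists (coord 0 w); near=> s; apply: (path_before w).
    by near: s; exact: nbhs_left_lt.
  move: tT; rewrite le_eqVlt => /predU1P[->|tT].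
    exists (coord T%:num w).
    exact: (@path_left_continuous_end _ _ w _ (discrete_set1 _)).
  have [l wl] := path_left_limit w (introT andP (conj t0 tT)).
  by exists l; exact: (wl _ (discrete_set1 _)).
have wr : \forall s \near t^'+, coord s w = coord t w.
  move: tT; rewrite le_eqVlt => /predU1P[->|tT].
    by near=> s; apply: (path_after w); near: s; exact: nbhs_right_gt.
  exact: (path_right_continuous (c := w) (introT andP (conj t0 tT))
           (discrete_set1 _)).
exists (maxn l (coord t w)); near=> s.
have [st|ts|->] := ltgtP s t; last by rewrite leq_maxr.
  suff -> : coord s w = l by rewrite leq_maxl.
  by move: st; near: s; exact: wl.
suff -> : coord s w = coord t w by rewrite leq_maxr.
by move: ts; near: s; exact: wr.
Unshelve. all: by end_near.
Qed.

(** Local boundedness spreads to the compact interval [0, T]. *)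
Lemma path_bounded (w : Omega T) :
  exists n : nat, forall t, t \in `[0, T%:num] -> (coord t w <= n)%N.
Proof.
have /compact_near_coveringP cpt := @segment_compact R 0 T%:num.
suff [N _ /(_ N (leqnn N)) wN] :
    \forall n \near \oo, `[0, T%:num] `<=` [set t | (coord t w <= n)%N].
  by exists N.
apply: cpt => t tT; have [n wn] := path_locally_bounded w tT.
exists ([set s | (coord s w <= n)%N], [set m | (n <= m)%N]).
  by split => //; exact: nbhs_infty_ge.
by move=> [s m] [/=]; exact: leq_trans.
Qed.

Lemma coord_le_path_norm (w : Omega T) (t : R) : t \in `[0, T%:num] ->
  (coord t w)%:R <= path_norm w T%:num.
Proof.
move=> tT; have [n wn] := path_bounded w.
apply: ub_le_sup.
  by exists n%:R => _ [s sT <-]; rewrite ger0_norm// ler_nat wn.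
by exists t => //; rewrite ger0_norm.
Qed.

Lemma moment_law (Q : probability (Omega T) R) (p : nat) (t : R) :
  moment p (law Q t) = (\int[Q]_w ((coord t w)%:R ^+ p)%:E)%E.
Proof.
by rewrite /moment /law ge0_integral_distribution.
Qed.

Lemma path_probs2_moment (Q : probability (Omega T) R) (t : R) :
  t \in `[0, T%:num] -> path_probs2 Q -> probs_with_moment 2 (law Q t).
Proof.
move=> tT; rewrite /probs_with_moment /= moment_law; apply: le_lt_trans.
apply: ge0_le_integral_nonmeasurable => w _; rewrite lee_fin ?exprn_ge0//.
have wn := coord_le_path_norm w tT.
by rewrite lerXn2r ?nnegrE// (le_trans _ wn).
Qed.

Lemma dirac_moment (w : Omega T) (p : nat) (t : R) :
  probs_with_moment p (law (dirac w : probability (Omega T) R) t).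
Proof.
rewrite /probs_with_moment /= moment_law integral_dirac//; last first.
  apply/measurable_EFinP.
  have mX : measurable_fun [set: nat] (fun n => n%:R ^+ p : R) by [].
  exact: (measurableT_comp mX (measurable_funPT (coord t))).
by rewrite diracT mul1e ltry.
Qed.

Section costs.
Context (U : metricType R) (P : probability (Omega T) R)
  (xi : probability nat R) (g : nat -> nat -> R)
  (lam : nat -> nat -> R -> Omega T -> probability nat R -> U -> R)
  (f : R -> Omega T -> probability nat R -> U -> R)
  (h : nat -> probability nat R -> R).

(** The controlled law is defined by definite description, so there are two
    cases: a solution of the fixed-point equation lies in P_2(Omega) by
    definition, and the default value in the absence of solutions is the Dirac
    mass at the zero path, all of whose marginals are Dirac masses. *)
Lemma controlled_law_moment (u : R -> Omega T -> U) (t : R) :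
  t \in `[0, T%:num] ->
  probs_with_moment 2 (law (controlled_law P xi g lam u) t).
Proof.
move=> tT; rewrite /controlled_law.
have [[Q QP]|noQ] := pselect (exists Q, is_controlled_law P xi g lam u Q).
  by have [+ _ _] := getI QP; exact: path_probs2_moment.
rewrite getPN; first exact: dirac_moment.
by move=> Q QP; apply: noQ; exists Q.
Qed.

Lemma cost_bounded : costs_bounded f h ->
  exists M : R, forall u, (`|cost P xi g lam f h u| <= M%:E)%E.
Proof.
move=> [C fhC]; exists (C * T%:num + C) => u; rewrite /cost unlock.
set Q := controlled_law _ _ _ _ _.
rewrite -[leRHS]mule1 -(probability_setT Q).
apply: abse_integral_le_bound => //.
  exact: (le_lt_trans (probability_le1 Q measurableT) (ltry _)).
move=> w _; rewrite lee_fin.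
have hT : T%:num \in `[0, T%:num] by rewrite in_itv/= lexx andbT.
apply: le_trans (ler_normD _ _) _; apply: lerD; last first.
  exact: (fhC _ (controlled_law_moment u hT)).2.
have : (`|\int[lebesgue_measure]_(t in `[0%R, T%:num])
    (f t w (law Q t) (u t w))%:E| <= (C * T%:num)%:E)%E.
  have mT : (lebesgue_measure `[0%R, T%:num] = T%:num%:E :> \bar R)%E.
    by rewrite lebesgue_measure_itv/= lte_fin gt0// sube0.
  rewrite EFinM -mT; apply: abse_integral_le_bound => //.
    by apply: (le_lt_trans (y := T%:num%:E) _ (ltry _)); rewrite -mT.
  move=> t tT; rewrite lee_fin.
  exact: (fhC _ (controlled_law_moment u tT)).1.
(* [fine] sends infinite values to 0 and so cannot increase the modulus. *)
by rewrite /Rintegral; case: integral.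
Qed.

(** A preimage under a constant map is empty or everything, and both sets belong
    to every sigma-algebra. *)
Lemma constant_control (v : U) : controls P (fun _ _ => v).
Proof.
move=> t tT /= A _.
have [vA|nvA] := pselect (A v).
  rewrite (_ : _ @^-1` _ = setT) ?setIT; last by apply/seteqP; split.
  rewrite -[X in _ X](setD0 (`[0, t] `*` [set: Omega T])).
  by apply: sigma_algebraCD; exact: sigma_algebra0.
rewrite (_ : _ @^-1` _ = set0) ?setI0; last by apply/seteqP; split.
exact: sigma_algebra0.
Qed.

End costs.
End paths.

Theorem proposition4p11 (R : realType) (T : {posnum R})
  (g : nat -> nat -> R) (xi : probability nat R) (x0 : nat)
  (P : probability (Omega T) R)
  (U : metricType R)
  (lam : nat -> nat -> R -> Omega T -> probability nat R -> U -> R)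
  (f : R -> Omega T -> probability nat R -> U -> R)
  (h : nat -> probability nat R -> R)
  (g_q_matrix : q_matrix g)
  (g_exp_moment : exp_jump_moment g)
  (g_bounded_below : rates_bounded_below g)
  (xi_dirac : forall B : set nat, xi B = \d_x0 B)
  (P_markov : markov_chain P g xi)
  (U_nonempty : [set: U] !=set0)
  (U_compact : compact [set: U])
  (B1 : intensities_predictable P xi g lam)
  (B2 : intensities_bounded_below g lam)
  (B3 : intensities_growth g lam)
  (B4 : intensities_lipschitz g lam)
  (B5 : intensities_square_growth g lam)
  (B6 : exp_moment xi)
  (f_measurable : running_cost_measurable f)
  (h_measurable : terminal_cost_measurable h)
  (B7 : costs_adapted P f h)
  (B8 : costs_lipschitz f h)
  (B9 : costs_bounded f h) :
  forall eps : R, 0 < eps ->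
    exists2 ueps : R -> Omega T -> U, controls P ueps &
      (cost P xi g lam f h ueps <=
         ereal_inf [set cost P xi g lam f h u | u in controls P (U := U)] +
         eps%:E)%E.
Proof.
have [v _] := U_nonempty; have [M JM] := cost_bounded P xi g lam B9.
move=> eps eps0; set J := [set _ | _ in _].
have Jfin : ereal_inf J \is a fin_num.
  rewrite fin_numElt; apply/andP; split.
    apply: (@lt_le_trans _ _ (- M%:E)%E); first by rewrite ltNyr.
    apply: le_ereal_inf_tmp => _ [u _ <-]; rewrite leeNl.
    by apply: le_trans (lee_abs _) _; rewrite abseN; exact: JM.
  apply: (@le_lt_trans _ _ (cost P xi g lam f h (fun _ _ => v))).
    apply: ereal_inf_lbound; exists (fun _ _ => v) => //.
    exact: constant_control.
  exact: le_lt_trans (le_trans (lee_abs _) (JM _)) (ltry _).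
have [_ [u uP <-] uJ] := lb_ereal_inf_adherent eps0 Jfin.
by exists u => //; exact: ltW.
Qed.
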